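(* Let $T\in\mathcal{B}(\mathcal{H})$ and $\alpha\in\mathbb{C}\setminus\{0\}$ with $\|\alpha T-I\|\le 1$. Then for all $x,y\in\mathcal{H}$ $$\left|\langle Tx,y\rangle-\frac1\alpha\langle x,y\rangle\right|\le\frac{1}{|\alpha|}\|x\|\|y\|$$ and $$|\langle Tx,y\rangle|\le\left|\langle Tx,y\rangle-\frac1\alpha\langle x,y\rangle\right|+\frac1{|\alpha|}|\langle x,y\rangle|\le\frac1{|\alpha|}\bigl(|\langle x,y\rangle|+\|x\|\|y\|\bigr).$$ Conversely-type statement: if $T\in\mathcal{B}(\mathcal{H})$ and for some $\alpha\in\mathbb{C}\setminus\{0\}$ the inequality $$|\langle Tx,y\rangle|\le\frac1{|\alpha|}\bigl(|\langle x,y\rangle|+\|x\|\|y\|\bigr)$$ holds for all $x,y\in\mathcal{H}$, then $\mathrm{dist}(\alpha T,\mathbb{C}I)\le 1$.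
   Context: $\mathcal{H}$ is a separable nontrivial complex Hilbert space, $\mathcal{B}(\mathcal{H})$ is the algebra of bounded linear operators on $\mathcal{H}$ with the operator norm, and $I$ is the identity operator. For $S\in\mathcal{B}(\mathcal{H})$, $\mathrm{dist}(S,\mathbb{C}I)=\inf_{\beta\in\mathbb{C}}\|S-\beta I\|$. *)

(* Defs.v *)
From HB Require Import structures.
From mathcomp Require Import all_boot all_order all_algebra sesquilinear.
From mathcomp Require Import complex.
From mathcomp Require Import all_classical all_reals.
From mathcomp Require Import topology normedtype.

Set Implicit Arguments.
Unset Strict Implicit.
Unset Printing Implicit Defensive.
Import Order.TTheory GRing.Theory Num.Theory.
Import numFieldNormedType.Exports.
Local Open Scope complex_scope.
Local Open Scope classical_set_scope.
Local Open Scope ring_scope.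

(* The complete norm and the inner product (linear in its first argument,
   conjugate-linear in its second) are tied by the last field. *)
HB.mixin Record CompleteNormedModule_isHilbert (R : realType) H
    of CompleteNormedModule R[i] H := {
  inner : {dot H for @Num.conj R[i]};
  innerxx : forall x : H, inner x x = `|x| ^+ 2
}.

#[short(type="hilbertType")]
HB.structure Definition Hilbert (R : realType) :=
  {H of CompleteNormedModule_isHilbert R H & CompleteNormedModule R[i] H}.

Notation "''[' x , y ]" := (inner x y) : ring_scope.

Definition separable (T : topologicalType) : Prop :=
  exists2 S : set T, countable S & dense S.

Section BoundedOperators.
Variables (R : realType) (H : hilbertType R).
Implicit Types S : H -> H.

Definition bounded_operator S : Prop :=
  exists M : R[i], forall x, `|S x| <= M * `|x|.

(* Norms live in R[i], hence the real part. As a supremum in R, this is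
   meaningful only when S is bounded on the unit ball. *)
Definition opnorm S : R :=
  sup [set complex.Re `|S x| | x in [set x : H | `|x| <= 1]].

Definition dist_scalars S : R :=
  inf [set opnorm (S \- beta \*: idfun) | beta in [set: R[i]]].

End BoundedOperators.

(* Main.v *)
Require Import Defs.
From HB Require Import structures.
From mathcomp Require Import all_boot all_order all_algebra sesquilinear.
From mathcomp Require Import complex.
From mathcomp Require Import all_classical all_reals.
From mathcomp Require Import topology normedtype.
From mathcomp Require Import ring lra.

(** The first half is the Cauchy-Schwarz inequality applied to
    [T - alpha^-1 = alpha^-1 (alpha T - 1)] together with the triangle
    inequality.

    For the second half put [A = alpha T] and write [|.|] for norms.  When
    [<x, y> = 0] the assumption says [|<A x, y>| <= |x| |y|].  Taking for [y] the
    component of [A x] orthogonal to a unit vector [x] gives the variance bound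
    [|A x|^2 - |<A x, x>|^2 <= 1], which persists for every [A - b]
    ([variance_le1]).  What remains is the Stampfli-type fact that such a bound
    forces [dist(A, C) <= 1].  Suppose that [m = dist(A, C) > 1], and let
    [B = A - b] have norm almost [m].  At a unit vector [x] with [|B x|] almost
    [m] the number [w = <B x, x>] cannot be small, since
    [|w|^2 >= |B x|^2 - 1].  On the other hand:

    - [|B - s w| >= m] for a small [s > 0], so there is a unit vector [y] with
      [|B y - s w y|] almost [m]; expanding the square, [|B y|] is almost [m] too,
      and [v = <B y, y>] satisfies [Re (v w^* ) <= small];

    - the values [<B z, z>] at unit vectors [z] with [|B z|] almost [m] fill the
      segments between any two of them, at the price of doubling the defect
      [|B|^2 - |B z|^2] ([near_maximal_segment], a quantitative form of the
      Toeplitz-Hausdorff theorem).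

    The segment from [w] to [v] turns towards the origin, so a suitable point on
    it has a squared modulus smaller by a constant depending only on [m]
    ([descent_step]).  The number of steps after which [|<B x, x>|^2] would be
    negative is therefore known beforehand, and the initial defect can be chosen
    so small that it survives all the doublings ([descent]): a contradiction.
    Working with almost optimal [b], [x], [y] avoids showing that the distance
    is attained. *)

Set Implicit Arguments.
Unset Strict Implicit.
Unset Printing Implicit Defensive.
Import Order.TTheory GRing.Theory Num.Theory.
Import numFieldNormedType.Exports.
Local Open Scope complex_scope.
Local Open Scope classical_set_scope.
Local Open Scope ring_scope.

(** * Complex numbers *)

Section ComplexModulus.
Variable R : realType.
Implicit Types a b : R[i].

Definition absq a : R := complex.Re a ^+ 2 + complex.Im a ^+ 2.

Lemma absqE a : `|a| ^+ 2 = (absq a)%:C.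
Proof. by rewrite -add_Re2_Im2. Qed.

Lemma absq_ge0 a : 0 <= absq a.
Proof. by rewrite addr_ge0 ?sqr_ge0. Qed.

(** The phase [w] turns the cross term of a quadratic form on a two-dimensional
    space into a real multiple of [D]; as [- w] does the same, the sign of
    [Re (w^* c)] can be prescribed as well. *)
Lemma exists_phase (g h c D : R[i]) : exists w : R[i],
  [/\ absq w = 1, 0 <= complex.Re (w^* * c)
    & complex.Im ((w * g + w^* * h) * D^*) = 0].
Proof.
pose k := (g * D^* - (h * D^* )^* : R[i]).
(* The imaginary part to be killed is that of [w * k]. *)
have [w [w1 wk]] : exists w : R[i], absq w = 1 /\ complex.Im (w * k) = 0.
  have [k0|k_neq0] := eqVneq k 0.
    by exists 1; rewrite k0 mulr0 /absq /= expr1n expr0n addr0.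
  have nk : absq k != 0 by rewrite -(inj_eq (@complexI R)) -absqE sqrf_eq0 normr_eq0.
  pose s := Num.sqrt (absq k); have s2 : s ^+ 2 = absq k by rewrite sqr_sqrtr ?absq_ge0.
  have s0 : s != 0 by rewrite -sqrf_eq0 s2.
  exists (s^-1%:C * k^*).
  move: s2; case: (k) => a b; rewrite /absq /= => s2; split; last by ring.
  rewrite !(mul0r, addr0, subr0, add0r) !exprMn sqrrN -mulrDr -s2 exprVn.
  by rewrite mulVf // expf_neq0.
have wIm : complex.Im ((w * g + w^* * h) * D^*) = 0.
  rewrite -wk /k; case: (w) (g) (h) (D) => [? ?] [? ?] [? ?] [? ?] /=; ring.
have [cp|cn] := leP 0 (complex.Re (w^* * c)); first by exists w.
exists (- w); split.
- by rewrite -w1 /absq; case: (w) => ? ? /=; rewrite !sqrrN.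
- by rewrite rmorphN mulNr; move: cn; case: (w^* * c) => ? ? /=; lra.
- rewrite rmorphN -(oppr0 R) -wIm.
  by case: (w) (g) (h) (D) => [? ?] [? ?] [? ?] [? ?] /=; ring.
Qed.

(** The derivative of the left-hand side at [s = 0] is
    [2 Re (v w^* ) - 2 |w|^2 <= - eps]; the last term absorbs the second order. *)
Lemma absq_segment (v w : R[i]) (M eps s : R) :
  0 <= eps -> absq v <= M -> absq w <= M -> eps <= absq w ->
  complex.Re (v * w^*) <= eps / 2 ->
  0 <= s <= 1 ->
  absq ((1 - s)%:C * w + s%:C * v) <= absq w - s * eps + 2 * s ^+ 2 * M.
Proof.
move=> e0 vM wM ew ve /andP[s0 s1].
have -> : absq ((1 - s)%:C * w + s%:C * v) = (1 - s) ^+ 2 * absq w +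
   2 * s * (1 - s) * complex.Re (v * w^*) + s ^+ 2 * absq v.
  by rewrite /absq; case: (v) (w) => [? ?] [? ?] /=; ring.
move: vM wM ew ve; move: (absq v) (absq w) (complex.Re _) => V W r vM wM ew ve.
have h1 : 0 <= s * (1 - s) * (eps / 2 - r) by rewrite !mulr_ge0 // subr_ge0.
have h2 : 0 <= s ^+ 2 * (M - V) by rewrite mulr_ge0 ?sqr_ge0 // subr_ge0.
have h3 : 0 <= s ^+ 2 * (M - W) by rewrite mulr_ge0 ?sqr_ge0 // subr_ge0.
have h4 : 0 <= s * (W - eps) by rewrite mulr_ge0 // subr_ge0.
have h5 : 0 <= s ^+ 2 * eps by rewrite mulr_ge0 ?sqr_ge0.
nra.
Qed.

End ComplexModulus.

(** * Inner products with real squared norms *)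

Section InnerProduct.
Variables (R : realType) (H : hilbertType R).
Implicit Types x y z : H.

(** Squared norms are taken in [R] because the order of [R[i]] is only partial. *)
Definition nsq x : R := complex.Re '[x, x].

Lemma innerC x y : '[x, y] = '[y, x]^*.
Proof. by have := hermC (@inner R H) x y; rewrite expr0 mul1r. Qed.

Lemma innerZl (a : R[i]) x y : '[a *: x, y] = a * '[x, y].
Proof. by rewrite linearZl_LR. Qed.
Lemma innerZr (a : R[i]) x y : '[x, a *: y] = a^* * '[x, y].
Proof. by rewrite linearZr_LR. Qed.
Lemma innerDl x y z : '[x + y, z] = '[x, z] + '[y, z].
Proof. by rewrite linearDl. Qed.
Lemma innerDr x y z : '[x, y + z] = '[x, y] + '[x, z].
Proof. by rewrite linearDr. Qed.

Lemma innerBl x y z : '[x - y, z] = '[x, z] - '[y, z].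
Proof. by rewrite linearBl. Qed.

Lemma inner_nsq x : '[x, x] = (nsq x)%:C.
Proof. by rewrite RRe_real // innerxx realX // normr_real. Qed.

Lemma norm_nsq x : `|x| ^+ 2 = (nsq x)%:C.
Proof. by rewrite -inner_nsq innerxx. Qed.

Lemma Re_norm x : (complex.Re `|x|)%:C = `|x|.
Proof. by rewrite RRe_real // normr_real. Qed.

Lemma Re_norm_ge0 x : 0 <= complex.Re `|x|.
Proof. by rewrite -ler0c Re_norm. Qed.

Lemma Re_norm_sqr x : complex.Re `|x| ^+ 2 = nsq x.
Proof. by apply: complexI; rewrite rmorphXn /= Re_norm norm_nsq. Qed.

Lemma nsq_ge0 x : 0 <= nsq x.
Proof. by rewrite -Re_norm_sqr sqr_ge0. Qed.

Lemma nsq_eq0 x : (nsq x == 0) = (x == 0).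
Proof. by rewrite -Re_norm_sqr sqrf_eq0 -(inj_eq (@complexI R)) Re_norm normr_eq0. Qed.

Lemma nsqD x y : nsq (x + y) = nsq x + nsq y + 2 * complex.Re '[x, y].
Proof.
rewrite /nsq innerDl !innerDr (innerC y x).
by case: '[x, x] '[y, y] '[x, y] => [? ?] [? ?] [? ?] /=; ring.
Qed.

Lemma nsqZ (a : R[i]) x : nsq (a *: x) = absq a * nsq x.
Proof.
rewrite /nsq innerZl innerZr inner_nsq /absq.
by case: a => ? ? /=; ring.
Qed.

Lemma nsqB x (a : R[i]) y :
  nsq (x - a *: y) = nsq x - 2 * complex.Re ('[x, y] * a^*) + absq a * nsq y.
Proof.
rewrite -scaleNr nsqD nsqZ innerZr /absq.
by case: a '[x, y] => [? ?] [? ?] /=; ring.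
Qed.

Lemma inner_cauchy_schwarz x y : absq '[x, y] <= nsq x * nsq y.
Proof.
have [->|y0] := eqVneq y 0.
  by rewrite linear0r /absq /= expr0n addr0 mulr_ge0 ?nsq_ge0.
have ny : 0 < nsq y by rewrite lt0r nsq_eq0 y0 nsq_ge0.
have := nsq_ge0 ((nsq y)%:C *: x - '[x, y] *: y).
rewrite nsqB nsqZ innerZl -(pmulr_rge0 _ ny) {1}/absq /=.
have -> : complex.Re ((nsq y)%:C * '[x, y] * '[x, y]^*) = nsq y * absq '[x, y].
  by rewrite /absq; case: '[x, y] => ? ? /=; ring.
move: ny (nsq_ge0 x) (absq_ge0 '[x, y]); move: (nsq y) (nsq x) (absq _) => a b c a0 b0 c0.
have -> : a * ((a ^+ 2 + 0 ^+ 2) * b - 2 * (a * c) + c * a) =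
   a ^+ 2 * (b * a - c) by ring.
by rewrite pmulr_rge0 ?exprn_gt0 // subr_ge0.
Qed.

Lemma nsq_normalize x : x != 0 -> exists r : R, nsq (r%:C *: x) = 1.
Proof.
move=> x0; exists (complex.Re `|x|)^-1.
rewrite nsqZ /absq /= expr0n addr0 -Re_norm_sqr exprVn mulVf //.
by rewrite Re_norm_sqr nsq_eq0.
Qed.

End InnerProduct.

(** * The numerical range at almost maximal vectors *)

Section MaximalNumericalRange.
Variables (R : realType) (H : hilbertType R) (B : {linear H -> H}) (K : R).
Hypothesis B_le : forall x, nsq (B x) <= K * nsq x.

(** The defect [K |x|^2 - |B x|^2] is a nonnegative quadratic form, so by the
    parallelogram law it is subadditive up to a factor 2. *)
Lemma defect_add x u (d e : R) :
  K * nsq x - nsq (B x) <= d -> K * nsq u - nsq (B u) <= e ->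
  K * nsq (x + u) - nsq (B (x + u)) <= 2 * d + 2 * e.
Proof.
move=> dx eu; have := B_le (x - 1 *: u).
rewrite (linearB B) (linearZ_LR B) (linearD B) !nsqB !nsqD /absq /=.
rewrite expr1n expr0n addr0 !mul1r.
move: dx eu; case: ('[x, u]) ('[B x, B u]) => [? ?] [? ?] /= *; lra.
Qed.

Lemma quadratic_pos_root (r t : R) : 0 < t < 1 ->
  exists2 s, 0 <= s & (1 - t) * s ^+ 2 - r * s - t = 0.
Proof.
move=> /andP[t0 t1]; pose D := r ^+ 2 + 4 * (t * (1 - t)).
have t1' : 0 < 1 - t by rewrite subr_gt0.
have tt : 0 <= 4 * (t * (1 - t)) by rewrite !mulr_ge0 // ltW.
have D0 : 0 <= D by rewrite addr_ge0 ?sqr_ge0.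
have D2 : Num.sqrt D ^+ 2 = D by rewrite sqr_sqrtr.
exists ((r + Num.sqrt D) / (2 * (1 - t))).
  rewrite divr_ge0 ?mulr_ge0 ?(ltW t1') //.
  rewrite -[r]opprK addrC subr_ge0 (le_trans (ler_norm _)) // normrN -sqrtr_sqr.
  by rewrite ler_wsqrtr // lerDl.
have -> : (1 - t) * ((r + Num.sqrt D) / (2 * (1 - t))) ^+ 2
    - r * ((r + Num.sqrt D) / (2 * (1 - t))) - t
    = (Num.sqrt D ^+ 2 - D) / (4 * (1 - t)).
  by rewrite /D; field; rewrite gt_eqF.
by rewrite D2 subrr mul0r.
Qed.

(** The witness is [z = x + s u], normalized, where [u] is [y] multiplied by a
    phase.  With [w0] the prescribed value, [<(B - w0) z, z>] is a multiple of
    [D = <B x, x> - <B y, y>] by a real quadratic polynomial in [s] whose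
    leading and constant coefficients have opposite signs, hence with a
    nonnegative root.  The other freedom in the phase makes [Re <x, u> >= 0], so that
    [|z|^2 >= 1 + s^2]: the normalization does not blow up the defect even if [x]
    and [y] are almost parallel. *)
Lemma near_maximal_segment x y (d t : R) :
  nsq x = 1 -> nsq y = 1 -> K - nsq (B x) <= d -> K - nsq (B y) <= d ->
  0 < t < 1 ->
  exists z, [/\ nsq z = 1, K - nsq (B z) <= 2 * d
    & '[B z, z] = (1 - t)%:C * '[B x, x] + t%:C * '[B y, y]].
Proof.
move=> x1 y1 dx dy tt.
pose p := '[B x, x]; pose q := '[B y, y]; pose D : R[i] := p - q.
have d0 : 0 <= d by have := B_le x; rewrite x1 mulr1; lra.
have [D0|Dneq0] := eqVneq D 0.
  exists x; split=> //; first by lra.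
  have -> : '[B y, y] = '[B x, x] by apply/esym/subr0_eq.
  by rewrite -mulrDl -rmorphD subrK mul1r.
pose w0 : R[i] := (1 - t)%:C * p + t%:C * q.
pose cross u := '[B u, x] + '[B x, u] - w0 * ('[u, x] + '[x, u]).
have [u [u1 du qu xu cruD]] : exists u, [/\ nsq u = 1, K - nsq (B u) <= d,
    '[B u, u] = q, 0 <= complex.Re '[x, u] & complex.Im (cross u * D^* ) = 0].
  have [w [w1 cw gw]] :=
    exists_phase ('[B y, x] - w0 * '[y, x]) ('[B x, y] - w0 * '[x, y]) '[x, y] D.
  exists (w *: y); split.
  - by rewrite nsqZ w1 y1 mulr1.
  - by rewrite (linearZ_LR B) nsqZ w1 mul1r.
  - rewrite (linearZ_LR B) innerZl innerZr mulrA -sqr_normc absqE w1.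
    by rewrite mul1r.
  - by rewrite innerZr.
  - rewrite -gw /cross (linearZ_LR B) !innerZl !innerZr.
    by congr (complex.Im _); ring.
pose cr := cross u.
pose r := complex.Re (cr / D).
have rE : cr = r%:C * D.
  rewrite /r RRe_real ?divfK //; apply/complex_realP.
  exists (complex.Re (cr * D^*) / absq D).
  have DD : D * D^* = (absq D)%:C by rewrite -absqE sqr_normc.
  have aD : (absq D)%:C != 0 by rewrite -absqE sqrf_eq0 normr_eq0.
  have crD : (complex.Re (cr * D^*))%:C = cr * D^*.
    by move: cruD; rewrite -/cr; case: (cr * _) => a b /= ->.
  rewrite rmorphM fmorphV /= crD.
  by rewrite -DD -mulf_div divff ?mulr1 // conjc_eq0.
have [s s0 sr] := quadratic_pos_root r tt.
pose z := x + s%:C *: u.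
have sq_s : absq s%:C = s ^+ 2 by rewrite /absq /= expr0n addr0.
have nz : 1 + s ^+ 2 <= nsq z.
  rewrite /z nsqD nsqZ u1 x1 mulr1 sq_s lerDl mulr_ge0 // innerZr.
  move: xu; case: '[x, u] => a b /= a0; rewrite oppr0 mul0r subr0.
  by rewrite mulr_ge0.
have z0 : z != 0 by rewrite -nsq_eq0 gt_eqF // (lt_le_trans _ nz) // ltr_wpDr ?sqr_ge0.
have Pz : K * nsq z - nsq (B z) <= 2 * d * nsq z.
  apply: (@le_trans _ _ (2 * d + 2 * (s ^+ 2 * d))).
    apply: defect_add; first by rewrite x1 mulr1.
    rewrite (linearZ_LR B) !nsqZ u1 sq_s mulr1 mulrC -mulrBr.
    by rewrite ler_wpM2l ?sqr_ge0.
  have -> : 2 * d + 2 * (s ^+ 2 * d) = 2 * d * (1 + s ^+ 2) by ring.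
  by rewrite ler_wpM2l // mulr_ge0.
have Bz : '[B z, z] = w0 * '[z, z].
  apply/subr0_eq; rewrite /z (linearD B) (linearZ_LR B).
  rewrite !innerDl !innerDr !innerZl !innerZr.
  have -> : (s%:C)^* = s%:C :> R[i] by exact: conjc_real.
  rewrite qu !inner_nsq x1 u1 -/p.
  have -> : p + s%:C * '[B x, u] + (s%:C * '[B u, x] + s%:C * (s%:C * q)) -
     w0 * (1%:C + s%:C * '[x, u] + (s%:C * '[u, x] + s%:C * (s%:C * 1%:C))) =
     p - w0 + s%:C * cr + s%:C ^+ 2 * (q - w0) by rewrite /cr /cross; ring.
  rewrite rE.
  have -> : p - w0 + s%:C * (r%:C * D) + s%:C ^+ 2 * (q - w0) =
     - ((1 - t) * s ^+ 2 - r * s - t)%:C * D.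
    by rewrite /D /w0 !(rmorphB, rmorphD, rmorphM, rmorphXn) /=; ring.
  by rewrite sr oppr0 mul0r.
have [c c1] := nsq_normalize z0.
exists (c%:C *: z); split=> //.
- rewrite (linearZ_LR B) nsqZ; move: c1; rewrite nsqZ; set a := absq _ => a1.
  have a0 : 0 <= a by exact: absq_ge0.
  have := ler_wpM2l a0 Pz; rewrite mulrBr mulrCA a1 mulr1.
  by rewrite [a * (2 * d * _)]mulrCA a1 mulr1.
- rewrite (linearZ_LR B) innerZl innerZr Bz.
  have -> : c%:C * ((c%:C)^* * (w0 * '[z, z])) = w0 * '[c%:C *: z, c%:C *: z].
    by rewrite innerZl innerZr; ring.
  by rewrite inner_nsq c1 mulr1.
Qed.

End MaximalNumericalRange.

(** * Operators bounded on orthogonal pairs *)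

(** Test the hypothesis on [x] and on the component [B x - <B x, x> x] of [B x],
    whose squared norm is the left-hand side. *)
Lemma variance_le1 (R : realType) (H : hilbertType R) (B : H -> H) (x : H) :
  (forall x y : H, '[x, y] = 0 -> absq '[B x, y] <= nsq x * nsq y) ->
  nsq x = 1 -> nsq (B x) - absq '[B x, x] <= 1.
Proof.
move=> B_orth x1; pose w := '[B x, x]; pose y := B x - w *: x.
have yx : '[y, x] = 0.
  by rewrite /y innerBl innerZl inner_nsq x1 mulr1 subrr.
have xy : '[x, y] = 0 by rewrite innerC yx rmorph0.
have yy : '[B x, y] = (nsq y)%:C.
  by rewrite -inner_nsq {2}/y innerBl innerZl xy mulr0 subr0.
have ny : nsq y = nsq (B x) - absq w.
  rewrite /y nsqB x1 mulr1 -/w /absq.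
  by case: (w) => a b /=; ring.
have := B_orth _ _ xy; rewrite yy x1 mul1r -/w -ny /absq /= expr0n addr0.
have := nsq_ge0 y; nra.
Qed.

Section Descent.
Variables (R : realType) (H : hilbertType R) (B : {linear H -> H}).
Variables (mu s : R).
(* [mu] stands for the squared distance to the scalars, [M] bounds the squared norm
   of [B], and [tau] is a lower bound for [|<B x, x>|^2] as long as the defect of
   [x] is at most [tau].  The shifts of [B] used below have size of order [s]; the
   errors in [B_le] and [B_shift] are [s^2], so that they are still of order [s]
   after the division by [s] which bounds [Re (v w^* )]. *)
Let M := mu + 1.
Let tau := (mu - 1) / 2.

Hypotheses (mu_gt1 : 1 < mu) (s_gt0 : 0 < s) (s_le1 : s <= 1).
Hypothesis B_orth :
  forall x y : H, '[x, y] = 0 -> absq '[B x, y] <= nsq x * nsq y.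
Hypothesis B_le : forall x, nsq (B x) <= (mu + s ^+ 2) * nsq x.
Hypothesis B_shift : forall b : R[i], exists2 x, nsq x = 1
  & mu - s ^+ 2 <= nsq (B x - b *: x).

Lemma absq_numrange_le x : nsq x = 1 -> absq '[B x, x] <= M.
Proof.
move=> x1; apply: (le_trans (inner_cauchy_schwarz _ _)).
rewrite x1 mulr1 (le_trans (B_le x)) // x1 mulr1 lerD2l.
by rewrite expr_le1 // ltW.
Qed.

(** Testing [B_shift] at [s <B x, x>] yields a vector whose numerical value [v] is
    almost not in the direction of [w = <B x, x>]; the new vector comes from the
    segment joining [w] to [v]. *)
Lemma descent_step (d : R) x :
  s * (2 + 3 * M) <= d -> d <= tau -> nsq x = 1 ->
  mu + s ^+ 2 - nsq (B x) <= d ->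
  exists z, [/\ nsq z = 1, mu + s ^+ 2 - nsq (B z) <= 2 * d
    & absq '[B z, z] <= absq '[B x, x] - tau ^+ 2 / (8 * M)].
Proof.
move=> sd dtau x1 dx.
have M0 : 0 < M by move: mu_gt1; rewrite /M; lra.
have tau0 : 0 < tau by rewrite divr_gt0 // subr_gt0.
pose w := '[B x, x].
have [y y1 ylow] := B_shift (s%:C * w).
pose v := '[B y, y].
have wM : absq w <= M by exact: absq_numrange_le.
have vM : absq v <= M by exact: absq_numrange_le.
have wtau : tau <= absq w.
  have := variance_le1 B_orth x1; rewrite -/w.
  have := sqr_ge0 s; move: dx dtau; rewrite /tau; lra.
have ylow' : mu - s ^+ 2 <= nsq (B y) - 2 * s * complex.Re (v * w^*) + s ^+ 2 * absq w.
  move: ylow; rewrite nsqB y1 mulr1 -/v /absq => h; apply: (le_trans h).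
  by rewrite le_eqVlt; apply/orP; left; apply/eqP; case: (v) (w) => [? ?] [? ?] /=; ring.
have yup : nsq (B y) <= mu + s ^+ 2 by rewrite -[leRHS]mulr1 -y1.
have vwM : - M <= complex.Re (v * w^*).
  have : complex.Re (v * w^*) ^+ 2 <= M ^+ 2.
    apply: (@le_trans _ _ (absq v * absq w)).
      rewrite -subr_ge0 (_ : _ - _ = complex.Im (v * w^*) ^+ 2) ?sqr_ge0 //.
      by rewrite /absq; case: (v) (w) => [? ?] [? ?] /=; ring.
    by rewrite expr2 ler_pM ?absq_ge0.
  move: (complex.Re _) M0 => r M0 rM; rewrite leNgt; apply/negP => rltM; nra.
have ss : s ^+ 2 <= s by rewrite expr2 ger_pMr.
have s2w : s ^+ 2 * absq w <= s ^+ 2 * M by rewrite ler_wpM2l ?sqr_ge0.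
have dy : mu + s ^+ 2 - nsq (B y) <= d by nra.
have vw : complex.Re (v * w^*) <= tau / 2.
  have : 2 * s * complex.Re (v * w^*) <= 2 * s * (tau / 2) by nra.
  by rewrite ler_pM2l // mulr_gt0.
(* This parameter minimizes the bound [- t tau + 2 t^2 M] on the change. *)
pose t := tau / (4 * M).
have tM : t * M = tau / 4 by rewrite /t; field; rewrite gt_eqF.
have t01 : 0 < t < 1.
  have M4 : 0 < 4 * M by rewrite mulr_gt0.
  apply/andP; split; first by rewrite divr_gt0.
  by rewrite ltr_pdivrMr // mul1r; move: mu_gt1; rewrite /tau /M; lra.
have [z [z1 dz zE]] := near_maximal_segment B_le x1 y1 dx dy t01.
exists z; split=> //; rewrite zE.
have t01' : 0 <= t <= 1 by case/andP: t01 => ? ?; rewrite !ltW.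
apply: (le_trans (absq_segment (ltW tau0) vM wM wtau vw t01')).
have -> : tau ^+ 2 / (8 * M) = t * tau / 2 by rewrite /t; field; rewrite gt_eqF.
rewrite (_ : 2 * t ^+ 2 * M = 2 * t * (t * M)); last by ring.
rewrite tM -/w; nra.
Qed.

Lemma descent n (d : R) : s * (2 + 3 * M) <= d -> 2 ^+ n * d <= tau ->
  exists x, [/\ nsq x = 1, mu + s ^+ 2 - nsq (B x) <= 2 ^+ n * d
    & absq '[B x, x] <= M - n%:R * (tau ^+ 2 / (8 * M))].
Proof.
move=> sd.
have M0 : 0 < M by move: mu_gt1; rewrite /M; lra.
have d0 : 0 < d by apply: lt_le_trans sd; rewrite mulr_gt0 // addr_gt0 // mulr_gt0.
elim: n => [|n IHn] dtau.
  have [x x1] := B_shift 0; rewrite scale0r subr0 => xlow.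
  exists x; split=> //; last by rewrite mul0r subr0 absq_numrange_le.
  have ss : s ^+ 2 <= s by rewrite expr2 ger_pMr.
  have : 0 < s * (3 * M) by rewrite !mulr_gt0.
  by rewrite expr0 mul1r; lra.
have nd : 0 < 2 ^+ n * d by rewrite mulr_gt0 ?exprn_gt0.
have dn : d <= 2 ^+ n * d by rewrite ler_peMl ?exprn_ege1 ?ler1n // ltW.
have dn_tau : 2 ^+ n * d <= tau by move: dtau; rewrite exprS -mulrA; lra.
have [x [x1 dx wx]] := IHn dn_tau.
have [z [z1 dz wz]] := descent_step (le_trans sd dn) dn_tau x1 dx.
exists z; split=> //; first by rewrite [2 ^+ n.+1]exprS -mulrA.
by move: wx wz; move: (_ / _) => c wx wz; rewrite -natr1 mulrDl mul1r; lra.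
Qed.

End Descent.

(** [mu] is the square of the distance from [A] to the scalars; the last two
    hypotheses express this without mentioning operator norms. *)
Lemma dist_scalars_sqr_le1 (R : realType) (H : hilbertType R)
    (A : {linear H -> H}) (mu : R) :
  (forall x y : H, '[x, y] = 0 -> absq '[A x, y] <= nsq x * nsq y) ->
  (forall e : R, 0 < e -> exists b : R[i],
     forall x, nsq (A x - b *: x) <= (mu + e) * nsq x) ->
  (forall (b : R[i]) (e : R), 0 < e -> exists2 x,
     nsq x = 1 & mu - e <= nsq (A x - b *: x)) ->
  mu <= 1.
Proof.
move=> A_orth A_le A_shift; rewrite leNgt; apply/negP => mu1.
pose M := mu + 1; pose tau := (mu - 1) / 2; pose c := tau ^+ 2 / (8 * M).
have M0 : 0 < M by move: mu1; rewrite /M; lra.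
have tau0 : 0 < tau by rewrite divr_gt0 // subr_gt0.
have c0 : 0 < c by rewrite divr_gt0 ?exprn_gt0 // mulr_gt0.
(* More than [M / c] descent steps would make [|<B x, x>|^2] negative. *)
pose N := Num.bound (M / c).
have NM : M < N%:R * c.
  by rewrite -ltr_pdivrMr // archi_boundP // divr_ge0 // ltW.
pose d := tau / 2 ^+ N; pose s := d / (2 + 3 * M).
have p0 : (0 : R) < 2 ^+ N by rewrite exprn_gt0.
have M3 : 0 < 2 + 3 * M by rewrite addr_gt0 // mulr_gt0.
have d0 : 0 < d by rewrite divr_gt0.
have s0 : 0 < s by rewrite divr_gt0.
have sd : s * (2 + 3 * M) = d by rewrite /s divfK // gt_eqF.
have Nd : 2 ^+ N * d = tau by rewrite /d mulrC divfK // gt_eqF.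
have dtau : d <= tau.
  by rewrite /d ler_pdivrMr // ler_peMr ?(ltW tau0) // exprn_ege1 // ler1n.
have s1 : s <= 1.
  rewrite /s ler_pdivrMr // mul1r (le_trans dtau) // /tau /M; lra.
have s2 : 0 < s ^+ 2 by rewrite exprn_gt0.
have [b Ab] := A_le _ s2.
pose B : {linear H -> H} := (A \- b \*: idfun).
have BE x : B x = A x - b *: x by [].
have B_orth (x y : H) : '[x, y] = 0 -> absq '[B x, y] <= nsq x * nsq y.
  move=> xy; rewrite BE innerBl innerZl xy mulr0 subr0.
  exact: A_orth.
have B_shift (b' : R[i]) : exists2 x, nsq x = 1 & mu - s ^+ 2 <= nsq (B x - b' *: x).
  have [x x1 xlow] := A_shift (b + b') _ s2; exists x => //.
  by rewrite BE -addrA -opprD -scalerDl.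
have sd' : s * (2 + 3 * M) <= d by rewrite sd.
have Nd' : 2 ^+ N * d <= tau by rewrite Nd.
have [x [_ _ xw]] := descent mu1 s0 s1 B_orth Ab B_shift sd' Nd'.
have := absq_ge0 '[B x, x]; move: xw NM; rewrite -/M -/tau -/c; lra.
Qed.

(** * Operator norms and the distance to the scalars *)

Section OperatorNorm.
Variables (R : realType) (H : hilbertType R).

Lemma norm_le_nsq (x y : H) : (`|x| <= `|y|) = (nsq x <= nsq y).
Proof. by rewrite -ler_sqr ?nnegrE ?normr_ge0 // !norm_nsq lecR. Qed.

Lemma norm_le1_nsq (x : H) : (`|x| <= 1) = (nsq x <= 1).
Proof. by rewrite -(expr_le1 (ltn0Sn 1)) ?normr_ge0 // norm_nsq -lecR. Qed.

Lemma norm_cauchy_schwarz (x y : H) : `|'[x, y]| <= `|x| * `|y|.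
Proof.
rewrite -ler_sqr ?nnegrE ?mulr_ge0 // exprMn absqE !norm_nsq -rmorphM lecR.
exact: inner_cauchy_schwarz.
Qed.

Lemma has_sup_opnorm (S : {linear H -> H}) : bounded_operator S ->
  has_sup [set complex.Re `|S x| | x in [set x : H | `|x| <= 1]].
Proof.
move=> [M SM]; split; first by exists (complex.Re `|S 0|), 0 => //=; rewrite normr0.
exists `|complex.Re M| => _ [x /= x1 <-].
have := SM x; rewrite -(Re_norm x) lecE => /andP[_].
have -> : complex.Re (M * (complex.Re `|x|)%:C) = complex.Re M * complex.Re `|x|.
  by case: M {SM} => a b /=; ring.
move=> h; apply: (le_trans h); rewrite (le_trans (ler_norm _)) // normrM.
by rewrite ler_piMr // ger0_norm ?Re_norm_ge0 // -lecR Re_norm.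
Qed.

Lemma opnorm_ge0 (S : {linear H -> H}) : bounded_operator S -> 0 <= opnorm S.
Proof.
move=> /has_sup_opnorm/sup_upper_bound ub; apply: le_trans (ub _ _).
  exact: (Re_norm_ge0 (S 0)).
by exists 0 => //=; rewrite normr0.
Qed.

Lemma nsq_le_opnorm (S : {linear H -> H}) x : bounded_operator S ->
  nsq (S x) <= opnorm S ^+ 2 * nsq x.
Proof.
move=> Sb; have [->|x0] := eqVneq x 0.
  by rewrite linear0 /nsq linear0r /= mulr0.
have [r r1] := nsq_normalize x0.
have : nsq (S (r%:C *: x)) <= opnorm S ^+ 2.
  rewrite -Re_norm_sqr ler_sqr ?nnegrE ?Re_norm_ge0 ?opnorm_ge0 //.
  apply: (sup_upper_bound (has_sup_opnorm Sb)).
  by exists (r%:C *: x); rewrite //= norm_le1_nsq r1.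
move: r1; rewrite (linearZ_LR S) !nsqZ; set a := absq _ => a1 aS.
by have := ler_wpM2r (nsq_ge0 x) aS; rewrite mulrAC a1 mul1r.
Qed.

(** A vector of the unit ball with a large image is nonzero, and normalizing it
    can only enlarge its image. *)
Lemma exists_unit_nsq_ge (S : {linear H -> H}) (c : R) : bounded_operator S ->
  0 <= c -> c < opnorm S -> exists2 x, nsq x = 1 & c ^+ 2 <= nsq (S x).
Proof.
move=> Sb c0 cS; have e0 : 0 < opnorm S - c by rewrite subr_gt0.
have [_ [y /= y1 <-]] := sup_adherent e0 (has_sup_opnorm Sb).
rewrite -/(opnorm S) subKr => cy.
have cSy : c ^+ 2 <= nsq (S y).
  by rewrite -Re_norm_sqr ler_sqr ?nnegrE ?Re_norm_ge0 // ltW.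
have y0 : y != 0.
  by apply: contraTneq cy => ->; rewrite linear0 normr0 -leNgt.
have [r r1] := nsq_normalize y0; exists (r%:C *: y) => //.
move: r1; rewrite (linearZ_LR S) !nsqZ; set a := absq _ => a1.
apply: (le_trans cSy); rewrite ler_peMl ?nsq_ge0 //.
by rewrite -a1 ler_piMr ?absq_ge0 // -norm_le1_nsq.
Qed.

Lemma bounded_operator_shift (T : {linear H -> H}) (a b : R[i]) :
  bounded_operator T -> bounded_operator (a \*: T \- b \*: idfun).
Proof.
move=> [M TM]; exists (`|a| * M + `|b|) => x /=.
rewrite (le_trans (ler_normB _ _)) // !normrZ mulrDl lerD // -mulrA.
by rewrite ler_wpM2l.
Qed.

Lemma dist_scalars_le_opnorm (T : {linear H -> H}) (a b : R[i]) :
  bounded_operator T -> dist_scalars (a \*: T) <= opnorm (a \*: T \- b \*: idfun).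
Proof.
move=> Tb; apply: ge_inf; last by exists b.
by exists 0 => _ [c _ <-]; apply: opnorm_ge0; apply: bounded_operator_shift.
Qed.

Lemma dist_scalars_le1 (T : {linear H -> H}) (a : R[i]) : bounded_operator T ->
  (forall x y : H, '[x, y] = 0 -> absq '[a *: T x, y] <= nsq x * nsq y) ->
  dist_scalars (a \*: T) <= 1.
Proof.
move=> Tb T_orth; rewrite leNgt; apply/negP; set m := dist_scalars _ => m1.
have m0 : 0 < m by apply: lt_trans m1.
suff : m ^+ 2 <= 1 by rewrite expr_le1 ?(ltW m0) // leNgt m1.
pose A : {linear H -> H} := (a \*: T).
apply: (@dist_scalars_sqr_le1 R H A) => // [e e0|b e e0].
- pose c := Num.sqrt (m ^+ 2 + e).
  have me0 : 0 < m ^+ 2 + e by rewrite addr_gt0 // exprn_gt0.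
  have c_gt : 0 < c - m.
    rewrite subr_gt0 -[ltLHS]ger0_norm ?(ltW m0) // -sqrtr_sqr ltr_sqrt //.
    by rewrite ltrDl.
  have [|_ [b _ <-]] := @inf_adherent R
      [set opnorm (a \*: T \- b \*: idfun) | b in [set: R[i]]] _ c_gt.
    split; first by exists (opnorm (a \*: T \- 0 \*: idfun)), 0.
    by exists 0 => _ [b _ <-]; apply: opnorm_ge0; apply: bounded_operator_shift.
  rewrite -/(dist_scalars _) -/m addrC subrK => bc; exists b => x.
  have Sb := bounded_operator_shift a b Tb.
  apply: (le_trans (nsq_le_opnorm x Sb)).
  rewrite ler_wpM2r ?nsq_ge0 // -[leRHS]sqr_sqrtr ?(ltW me0) //.
  by rewrite ler_sqr ?nnegrE ?sqrtr_ge0 ?opnorm_ge0 // ltW.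
- have Sb := bounded_operator_shift a b Tb.
  have c_lt : Num.sqrt (m ^+ 2 - e) < opnorm (a \*: T \- b \*: idfun).
    apply: lt_le_trans (dist_scalars_le_opnorm a b Tb).
    rewrite -/m -[ltRHS]ger0_norm ?(ltW m0) // -sqrtr_sqr ltr_sqrt ?exprn_gt0 //.
    by rewrite ltrBlDr ltrDl.
  have [x x1 cx] := exists_unit_nsq_ge Sb (sqrtr_ge0 _) c_lt.
  exists x => //; apply: le_trans cx.
  have [me|me] := leP 0 (m ^+ 2 - e); first by rewrite sqr_sqrtr.
  by rewrite (le_trans (ltW me)) ?sqr_ge0.
Qed.

End OperatorNorm.

(** * The two implications *)

Theorem proposition3p1 (R : realType) (H : hilbertType R)
    (Hsep : separable H) (Hnontrivial : exists x : H, x != 0) :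
  (forall (T : {linear H -> H}) (alpha : R[i]),
      bounded_operator T -> alpha != 0 ->
      opnorm (alpha \*: T \- idfun) <= 1 ->
    forall x y : H,
      `|'[T x, y] - alpha^-1 * '[x, y]| <= `|alpha|^-1 * (`|x| * `|y|) /\
      `|'[T x, y]| <=
        `|'[T x, y] - alpha^-1 * '[x, y]| + `|alpha|^-1 * `|'[x, y]| /\
      `|'[T x, y] - alpha^-1 * '[x, y]| + `|alpha|^-1 * `|'[x, y]| <=
        `|alpha|^-1 * (`|'[x, y]| + `|x| * `|y|)) /\
  (forall (T : {linear H -> H}) (alpha : R[i]),
      bounded_operator T -> alpha != 0 ->
      (forall x y : H,
        `|'[T x, y]| <= `|alpha|^-1 * (`|'[x, y]| + `|x| * `|y|)) ->
    dist_scalars (alpha \*: T) <= 1).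
Proof.
split=> T alpha Tb a0.
- move=> S1 x y.
  have Sb : bounded_operator (alpha \*: T \- idfun).
    have [M MS] := bounded_operator_shift alpha 1 Tb.
    by exists M => z; have := MS z; rewrite /= scale1r.
  have Sx : `|alpha *: T x - x| <= `|x|.
    rewrite norm_le_nsq (le_trans (nsq_le_opnorm x Sb)) //.
    by rewrite ler_piMl ?nsq_ge0 // expr_le1 ?opnorm_ge0.
  have xy : `|'[T x, y] - alpha^-1 * '[x, y]| <= `|alpha|^-1 * (`|x| * `|y|).
    have -> : '[T x, y] - alpha^-1 * '[x, y] = alpha^-1 * '[alpha *: T x - x, y].
      by rewrite innerBl innerZl mulrBr mulKf.
    rewrite normrM normfV ler_wpM2l ?invr_ge0 //.
    by rewrite (le_trans (norm_cauchy_schwarz _ _)) // ler_wpM2r.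
  split=> //; split; last by rewrite addrC mulrDr lerD2l.
  by rewrite -normfV -normrM -lerBlDr lerB_dist.
- move=> Txy; apply: dist_scalars_le1 => // x y xy.
  have := Txy x y; rewrite xy normr0 add0r ler_pdivlMl ?normr_gt0 //.
  rewrite -normrM -innerZl -ler_sqr ?nnegrE ?mulr_ge0 //.
  by rewrite exprMn absqE !norm_nsq -rmorphM lecR.
Qed.
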